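(* Let $K_A$ and $K_B$ be state spaces. There is a constant $c(A,B)$ depending only on $K_A$ and $K_B$ such that for every integer $n\ge 1$ and every $x_{AB}\in \operatorname{Ext}_n(K_A,K_B)$ there exists $\tilde x_{AB}\in K_A\dot\otimes K_B$ with $$\left\lVert \tilde x_{AB}-x_{AB}\right\rVert_{\star,1_{K_A\hat\otimes K_B}}\le \frac{2\,c(A,B)}{\sqrt n}.$$
   Context: A state space is a nonempty compact convex subset $K$ of a finite-dimensional real vector space. $A(K)$ is the real vector space of affine functions $K\to\mathbb R$, $A(K)^+=\{f\in A(K): f(x)\ge 0\ \forall x\in K\}$, $1_K\in A(K)$ is the constant function $1$. $A(K)^\star$ is the dual space, with dual cone $A(K)^{\star+}=\{\phi:\langle\phi,f\rangle\ge0\ \forall f\in A(K)^+\}$. $K$ is identified, via evaluation, with $\{\phi\in A(K)^{\star+}:\langle \phi,1_K\rangle=1\}$, and elements of $A(K)$ act as linear functionals on $A(K)^\star$. Tensor products. The maximal tensor product of cones $C_1\subseteq V_1$, $C_2\subseteq V_2$ is $C_1\hat\otimes C_2=\{z\in V_1\otimes V_2:(f_1\otimes f_2)(z)\ge0\ \forall f_1\in C_1^\star,f_2\in C_2^\star\}$; it is iterated associatively. $K_A\hat\otimes K_B$ is the state space of all $z\in A(K_A)^{\star+}\hat\otimes A(K_B)^{\star+}$ with $(1_{K_A}\otimes 1_{K_B})(z)=1$; similarly $K_A\hat\otimes K_B^{\hat\otimes n}$. $K_A\dot\otimes K_B=\operatorname{conv}\{x_A\otimes x_B:x_A\in K_A,x_B\in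 K_B\}$ (separable states). $A(K_A\hat\otimes K_B)$ is identified with $A(K_A)\otimes A(K_B)$, and $1_{K_A\hat\otimes K_B}=1_{K_A}\otimes1_{K_B}$. $n$-extendibility. $\operatorname{Ext}_n(K_A,K_B)$ is the set of $x_{AB}\in K_A\hat\otimes K_B$ for which there exists $y_{AB^n}\in K_A\hat\otimes K_B^{\hat\otimes n}$, invariant under all permutations of the $n$ tensor factors belonging to $B$, such that $x_{AB}=(\mathrm{id}_A\otimes\mathrm{id}_B\otimes 1_{K_B}^{\otimes(n-1)})(y_{AB^n})$. Norms. For a state space $K$ and $f\in A(K)$, $\|f\|_{1_K}=\inf\{t\ge0:-t1_K\le f\le t1_K\}$ (order-unit norm, with $\le$ the order induced by $A(K)^+$), and for $\phi\in A(K)^\star$, $\|\phi\|_{\star,1_K}=\sup\{|\langle\phi,g\rangle|:\|g\|_{1_K}\le1\}$. *)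

(* Defs.v *)
From HB Require Import structures.
From mathcomp Require Import all_boot all_order all_algebra.
From mathcomp Require Import all_classical all_reals all_analysis.
From mathcomp Require Import perm lra.
Set Implicit Arguments.
Unset Strict Implicit.
Unset Printing Implicit Defensive.
Import Order.TTheory GRing.Theory Num.Theory.
Import numFieldNormedType.Exports.
Local Open Scope classical_set_scope.
Local Open Scope ring_scope.

Lemma max_dimv_span (F : fieldType) (T : Type) (W : vectType F) (h : T -> W) :
  exists s : seq T, forall x, h x \in <<map h s>>%VS.
Proof.
pose P n := `[< exists s : seq T, n = \dim <<map h s>>%VS >].
have exP : exists n, P n by exists (\dim <<map h [::]>>%VS); apply/asboolP; exists [::].
have ubP n : P n -> (n <= \dim {:W})%N.
  by move=> /asboolP[s ->]; rewrite dimvS ?subvf.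
case: (ex_maxnP exP ubP) => n /asboolP[s nE] nmax; exists s => x.
have sub : (<<map h s>> <= <<map h (x :: s)>>)%VS.
  by apply: sub_span => v vs; rewrite inE vs orbT.
have : <<map h s>>%VS == <<map h (x :: s)>>%VS.
  by rewrite eqEdim sub -nE nmax//; apply/asboolP; exists (x :: s).
by move=> /eqP ->; apply: memv_span; rewrite inE eqxx.
Qed.

Lemma findim_inj (F : fieldType) (V : lmodType F) (W : vectType F)
    (h : {linear V -> W}) : injective h -> {n : nat & Vector.axiom n V}.
Proof.
move=> hI; have [s sP] := cid (max_dimv_span h).
pose U := <<map h s>>%VS.
have surj u : u \in U -> exists v, h v = u.
  move=> uU; rewrite (@coord_span _ _ _ (in_tuple (map h s)) _ uU).
  exists (\sum_i coord (in_tuple (map h s)) i u *: s`_(val i)).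
  rewrite linear_sum; apply: eq_bigr => i _; rewrite linearZ /= (nth_map 0)//.
  by rewrite -(size_map h); exact: ltn_ord.
have bP i : {v | h v = (vbasis U)`_i}.
  apply: cid; apply: surj; have [iU|iU] := ltnP i (size (vbasis U)).
    by apply: vbasis_mem; rewrite mem_nth.
  by rewrite nth_default// mem0v.
exists (\dim U), (fun v => \row_i coord (vbasis U) i (h v)).
  by move=> a u v; apply/rowP => i; rewrite !mxE !linearP.
have hsum (r : 'rV[F]_(\dim U)) : h (\sum_i r 0 i *: sval (bP i)) =
    \sum_i r 0 i *: (vbasis U)`_i.
  by rewrite linear_sum; apply: eq_bigr => i _; rewrite linearZ /= (svalP (bP i)).
exists (fun r : 'rV[F]_(\dim U) => \sum_i r 0 i *: sval (bP i)) => [v|r].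
  apply: hI; rewrite hsum [RHS](coord_vbasis (sP v)).
  by apply: eq_bigr => i _; rewrite mxE.
apply/rowP => i; rewrite mxE hsum coord_sum_free//.
exact: basis_free (vbasisP U).
Qed.

Record cvx (R : realType) (V : vectType R) := Cvx {
  cvx_set :> set V;
  cvx_convex : convex_set cvx_set }.

(* A finite-dimensional real space has a unique Hausdorff vector topology;
   a [vectType] carries no topology, so compactness is read on coordinates. *)
Record state_space (R : realType) (V : vectType R) := StateSpace {
  state_cvx :> cvx V;
  state_nonempty : state_cvx !=set0;
  state_compact : compact (passmx.rVof (vbasis {:V}) @` state_cvx) }.

Section affine.
Variables (R : realType) (V : vectType R) (K : cvx V).

Definition affine (f : K -> R^o) :=
  forall (x y z : K) (t : R), 0 <= t <= 1 ->
    val z = t *: val x + (1 - t) *: val y ->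
    f z = t * f x + (1 - t) * f y.

Definition affine_pred := [pred f : K -> R^o | `[< affine f >]].

Lemma affine_submod : submod_closed affine_pred.
Proof.
split=> [|a f g /asboolP fA /asboolP gA]; apply/asboolP => x y z t t01 zE.
  by rewrite /= !mulr0 addr0.
rewrite -[LHS]/(a * f z + g z) -![(a *: f + g) _]/(a * f _ + g _).
by rewrite (fA _ _ _ _ t01 zE) (gA _ _ _ _ t01 zE); lra.
Qed.

HB.instance Definition _ := GRing.isSubmodClosed.Build R (K -> R^o)
  affine_pred affine_submod.

(* A(K), the affine functions on K *)
Record AK := MkAK { AK_fun :> K -> R^o; AK_affine : AK_fun \in affine_pred }.
HB.instance Definition _ := [isSub for AK_fun].
HB.instance Definition _ := [Choice of AK by <:].
HB.instance Definition _ := [SubChoice_isSubLmodule of AK by <:].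

Lemma AKP (f : AK) : affine f. Proof. exact/asboolP/(AK_affine f). Qed.

Lemma AK_jensen (x0 : K) (s : seq (R * K)) : all (fun p => 0 <= p.1) s ->
  exists z : K, (\sum_(p <- s) p.1) *: val z = \sum_(p <- s) p.1 *: val p.2 /\
    forall f : AK, (\sum_(p <- s) p.1) * f z = \sum_(p <- s) p.1 * f p.2.
Proof.
elim: s => [_|[w x] s IH /= /andP[w0 s0]].
  by exists x0; rewrite !big_nil scale0r; split=> // f; rewrite big_nil mul0r.
have [z [zE fE]] := IH s0; rewrite !big_cons /=.
set W := \sum_(p <- s) p.1 in zE fE *.
have W0 : 0 <= W by rewrite /W big_seq sumr_ge0// => p ps; exact: (allP s0).
have [wW|wW] := eqVneq (w + W) 0.
  have w_0 : w = 0 by lra.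
  have W_0 : W = 0 by lra.
  exists z; rewrite -zE wW; split=> [|f]; first by rewrite w_0 W_0 !scale0r addr0.
  by rewrite big_cons -fE /= w_0 W_0 !mul0r addr0.
have wWgt : 0 < w + W by rewrite lt_neqAle eq_sym wW addr_ge0.
pose t := w / (w + W).
have t01 : 0 <= t <= 1.
  by rewrite /t divr_ge0 ?(ltW wWgt)//= ler_pdivrMr// mul1r lerDl.
have tE : (w + W) * t = w by rewrite /t mulrC divfK.
have tE' : (w + W) * (1 - t) = W by rewrite mulrBr tE; lra.
have yK : (t *: val x + (1 - t) *: val z) \in (K : set V).
  have := @cvx_convex _ _ K (val x) (val z) (Itv01 (andP t01).1 (andP t01).2).
  by apply; apply: valP.
pose y : K := SigSub yK.
exists y; split=> [|f].
  by rewrite /= scalerDr !scalerA tE tE' zE.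
rewrite big_cons -fE /= (AKP f t01 (erefl : val y = _)).
by rewrite [LHS]mulrDr [X in X + _]mulrA [X in _ + X]mulrA tE tE'.
Qed.

Lemma AK_findim : {n : nat & Vector.axiom n AK}.
Proof.
pose hat (x : K) : R^o * V := (1, val x).
have [s sP] := cid (max_dimv_span hat).
pose ev (f : AK) : 'rV[R]_(size s) := \row_i f (tnth (in_tuple s) i).
have evL : linear ev by move=> a f g; apply/rowP => i; rewrite !mxE.
pose evl : {linear AK -> 'rV[R]_(size s)} :=
  HB.pack ev (GRing.isLinear.Build _ _ _ _ ev evL).
apply: (@findim_inj _ _ _ evl); apply: raddf_inj => f fs0.
have {}fs0 i : f (tnth (in_tuple s) i) = 0.
  by have := congr1 (fun r : 'rV_ _ => r 0 i) fs0; rewrite !mxE.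
apply: val_inj; apply/funext => z /=.
pose x i := tnth (in_tuple s) i.
pose c := coord (map_tuple hat (in_tuple s)) ^~ (hat z).
have hatz : hat z = \sum_i c i *: hat (x i).
  rewrite [LHS](@coord_span _ _ _ (map_tuple hat (in_tuple s)) _ (sP z)).
  by apply: eq_bigr => i _; rewrite -tnth_nth tnth_map.
have sum_c : 1 = \sum_i c i.
  have /(congr1 fst) := hatz; rewrite (big_morph fst (id1 := 0) (op1 := +%R))//=.
  by move=> ->; apply: eq_bigr => i _; rewrite -[LHS]/(c i * 1) mulr1.
have sum_cx : val z = \sum_i c i *: val (x i).
  by have /(congr1 snd) := hatz; rewrite (big_morph snd (id1 := 0) (op1 := +%R)).
pose cp i := Num.max 0 (c i); pose cn i := Num.max 0 (- c i).
have cE i : c i + cn i = cp i.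
  by rewrite /cn /cp; case: (lerP 0 (c i)); case: (lerP 0 (- c i)); lra.
pose ps := [seq (cp i, x i) | i <- index_enum 'I_(size s)].
pose ns := (1 : R, z) :: [seq (cn i, x i) | i <- index_enum 'I_(size s)].
have [p [pE pfE]] : exists p : K,
    (\sum_(q <- ps) q.1) *: val p = \sum_(q <- ps) q.1 *: val q.2 /\
    forall f : AK, (\sum_(q <- ps) q.1) * f p = \sum_(q <- ps) q.1 * f q.2.
  by apply: AK_jensen => //; rewrite all_map; apply/allP => i _ /=; rewrite le_max lexx.
have [n [nE nfE]] : exists p : K,
    (\sum_(q <- ns) q.1) *: val p = \sum_(q <- ns) q.1 *: val q.2 /\
    forall f : AK, (\sum_(q <- ns) q.1) * f p = \sum_(q <- ns) q.1 * f q.2.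
  apply: AK_jensen => //=; rewrite ler01 all_map.
  by apply/allP => i _ /=; rewrite le_max lexx.
have WE : \sum_(q <- ns) q.1 = \sum_(q <- ps) q.1.
  rewrite big_cons !big_map /= sum_c -big_split /=.
  by apply: eq_bigr => i _; exact: cE.
have xE : \sum_(q <- ns) q.1 *: val q.2 = \sum_(q <- ps) q.1 *: val q.2.
  rewrite big_cons !big_map /= scale1r sum_cx -big_split /=.
  by apply: eq_bigr => i _; rewrite -scalerDl cE.
have W1 : 0 < \sum_(q <- ps) q.1.
  rewrite -WE big_cons big_map /= ltr_wpDr//.
  by apply: sumr_ge0 => i _; rewrite le_max lexx.
have np : n = p.
  apply: val_inj; apply: (scalerI (lt0r_neq0 W1)).
  by rewrite -[in LHS]WE nE pE xE.
have := nfE f; rewrite WE np pfE big_cons !big_map /= mul1r.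
under eq_bigr do rewrite fs0 mulr0.
under [X in _ = _ + X]eq_bigr do rewrite fs0 mulr0.
by rewrite !big1_eq addr0 => <-.
Qed.

HB.instance Definition _ :=
  Lmodule_hasFinDim.Build R AK (projT2 AK_findim).

End affine.

Section ordered_space.
Variables (R : realType).
Implicit Types V W : vectType R.

Definition dual V : vectType R := 'Hom(V, R^o).

Definition pairing V (f : dual V) (v : V) : R := (f : 'Hom(V, R^o)) v.

Lemma pairing_linearr V (f : dual V) : linear (pairing f : V -> R^o).
Proof. by move=> a u v; rewrite /pairing linearP. Qed.

Lemma pairing_linearl V (v : V) : linear (@pairing V ^~ v : dual V -> R^o).
Proof. by move=> a f g; rewrite /pairing add_lfunE scale_lfunE. Qed.

HB.instance Definition _ V (f : dual V) :=
  GRing.isLinear.Build R V R^o _ (pairing f) (pairing_linearr f).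

Definition ev V (v : V) : dual (dual V) := linfun (@pairing V ^~ v : dual V -> R^o).

Lemma evE V (v : V) f : pairing (ev v) f = pairing f v.
Proof.
pose h : {linear dual V -> R^o} :=
  HB.pack (@pairing V ^~ v)
    (GRing.isLinear.Build _ _ _ _ _ (pairing_linearl v)).
exact: (lfunE h).
Qed.

Definition dual_cone V (C : set V) : set (dual V) :=
  [set f | forall v, C v -> 0 <= pairing f v].

(* The canonical isomorphism V (x) W ~ Hom(W^*, V) of finite-dimensional
   spaces: a tensor [z] is stored as the map [g |-> (id (x) g)(z)]. *)
Definition tensor V W : vectType R := 'Hom(dual W, V).

Definition contract V W (g : dual W) (z : tensor V W) : V :=
  (z : 'Hom(dual W, V)) g.

Lemma contract_linear V W (g : dual W) : linear (@contract V W g).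
Proof. by move=> a y z; rewrite /contract add_lfunE scale_lfunE. Qed.

HB.instance Definition _ V W (g : dual W) :=
  GRing.isLinear.Build R (tensor V W) V _ (contract g) (@contract_linear V W g).

Definition tens V W (v : V) (w : W) : tensor V W :=
  linfun (fun g : dual W => pairing g w *: v).

Lemma contract_tens V W (v : V) (w : W) (g : dual W) :
  contract g (tens v w) = pairing g w *: v.
Proof.
have hL : linear (fun g : dual W => pairing g w *: v).
  by move=> a f h; rewrite pairing_linearl scalerDl -scalerA.
pose h : {linear dual W -> V} := HB.pack (fun g : dual W => pairing g w *: v)
  (GRing.isLinear.Build _ _ _ _ _ hL).
exact: (lfunE h).
Qed.

Definition tens_dual V W (f : dual V) (g : dual W) : dual (tensor V W) :=
  linfun (pairing f \o contract g : _ -> R^o).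

Lemma tens_dualE V W (f : dual V) (g : dual W) (z : tensor V W) :
  pairing (tens_dual f g) z = pairing f (contract g z).
Proof. exact: lfunE. Qed.

Lemma tens_dual_tens V W (f : dual V) (g : dual W) (v : V) (w : W) :
  pairing (tens_dual f g) (tens v w) = pairing f v * pairing g w.
Proof. by rewrite tens_dualE contract_tens linearZ mulrC. Qed.

Definition max_tensor V W (C : set V) (D : set W) : set (tensor V W) :=
  [set z | forall f g, dual_cone C f -> dual_cone D g ->
    0 <= pairing (tens_dual f g) z].

Definition conv_hull V (S : set V) : set V :=
  [set z | exists (m : nat) (w : 'I_m -> R) (s : 'I_m -> V),
    [/\ forall i, 0 <= w i, \sum_i w i = 1, forall i, S (s i) &
        z = \sum_i w i *: s i]].

(* V (x) W^{(x) n}, associated to the left. *)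
Fixpoint tensor_pow V W (n : nat) : vectType R :=
  if n is m.+1 then tensor (tensor_pow V W m) W else V.

Fixpoint max_tensor_pow V W (C : set V) (D : set W) (n : nat) :
    set (tensor_pow V W n) :=
  match n return set (tensor_pow V W n) with
  | 0 => C
  | m.+1 => max_tensor (@max_tensor_pow V W C D m) D
  end.

(* f (x) g_0 (x) ... (x) g_(n-1) *)
Fixpoint tens_dual_pow V W (f : dual V) (n : nat) :
    ('I_n -> dual W) -> dual (tensor_pow V W n) :=
  match n return ('I_n -> dual W) -> dual (tensor_pow V W n) with
  | 0 => fun=> f
  | m.+1 => fun g =>
      tens_dual (tens_dual_pow f (fun i : 'I_m => g (widen_ord (leqnSn m) i)))
                (g ord_max)
  end.

(* [y] is fixed by the permutations of the [n] factors [W], which act by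
   (f (x) g_0 (x) ... (x) g_(n-1)) (s y) = (f (x) g_(s 0) (x) ... ) (y); the
   product functionals span the dual of the tensor product. *)
Definition perm_invariant V W (n : nat) (y : tensor_pow V W n) :=
  forall (s : 'S_n) (f : dual V) (g : 'I_n -> dual W),
    pairing (tens_dual_pow f (g \o s)) y = pairing (tens_dual_pow f g) y.

(* id_V (x) id_W (x) h^{(x) n} *)
Fixpoint marginal V W (h : dual W) (n : nat) :
    tensor_pow V W n.+1 -> tensor V W :=
  match n return tensor_pow V W n.+1 -> tensor V W with
  | 0 => id
  | m.+1 => fun z => marginal h (contract h z)
  end.

End ordered_space.
Arguments max_tensor_pow {R V W} C D n _.

Section state_spaces.
Variables (R : realType) (V : vectType R) (K : cvx V).

Definition Apos : set (AK K) := [set f | forall x, 0 <= f x].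

Lemma Aone_subproof : (fun=> 1 : R^o) \in affine_pred K.
Proof. by apply/asboolP => x y z t _ _; lra. Qed.

Definition Aone : AK K := MkAK Aone_subproof.

(* A(K)^{*+}; it lives in A(K)^*, and [delta] embeds K in it. *)
Definition state_cone : set (dual (AK K)) := dual_cone Apos.

Lemma delta_linear (x : K) : linear (fun f : AK K => f x : R^o).
Proof. by []. Qed.

Definition delta (x : K) : dual (AK K) := linfun (fun f : AK K => f x : R^o).

Lemma deltaE (x : K) (f : AK K) : pairing (delta x) f = f x.
Proof.
pose h : {linear AK K -> R^o} :=
  HB.pack (fun f : AK K => f x : R^o)
    (GRing.isLinear.Build _ _ _ _ _ (delta_linear x)).
exact: (lfunE h).
Qed.

(* Norms take values in the extended reals, so that neither the infimum nor
   the supremum has a default value. *)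
Definition unit_norm (f : AK K) : \bar R :=
  ereal_inf [set t%:E | t in
    [set t : R | [/\ 0 <= t, Apos (f + t *: Aone) & Apos (t *: Aone - f)]]].

Definition dual_norm (phi : dual (AK K)) : \bar R :=
  ereal_sup [set `|pairing phi g|%:E | g in
    [set g : AK K | (unit_norm g <= 1)%E]].

End state_spaces.

Section composite.
Variables (R : realType) (VA VB : vectType R) (KA : cvx VA) (KB : cvx VB).
Local Notation A' := (dual (AK KA)).
Local Notation B' := (dual (AK KB)).

Lemma max_states_convex : convex_set
  [set z : tensor A' B' | max_tensor (@state_cone _ _ KA) (@state_cone _ _ KB) z /\
    pairing (tens_dual (ev (Aone KA)) (ev (Aone KB))) z = 1].
Proof.
move=> y z t; rewrite !inE => -[y0 y1] [z0 z1].
have lin (h : dual (tensor A' B')) : pairing h (conv t y z : tensor A' B') =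
    t%:num * pairing h y + (1 - t%:num) * pairing h z.
  by rewrite linearD !linearZ.
split=> [f g fP gP|]; rewrite lin.
  by rewrite addr_ge0// mulr_ge0// ?subr_ge0 ?y0 ?z0.
by rewrite y1 z1; lra.
Qed.

Definition max_states : cvx (tensor A' B') := Cvx max_states_convex.

Definition max_states_pow (n : nat) : set (tensor_pow A' B' n) :=
  [set y | max_tensor_pow (@state_cone _ _ KA) (@state_cone _ _ KB) n y /\
    pairing (tens_dual_pow (ev (Aone KA)) (fun _ : 'I_n => ev (Aone KB))) y = 1].

Definition separable : set (tensor A' B') :=
  conv_hull [set tens (delta a) (delta b) | a in [set: KA] & b in [set: KB]].

Lemma separable_max_states : separable `<=` max_states.
Proof.
move=> z [m [w [s [w0 w1 sS ->]]]].
have sE (f : dual A') (g : dual B') i : exists a b,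
    pairing (tens_dual f g) (s i) = pairing f (delta a) * pairing g (delta b).
  by have [a _ [b _ <-]] := sS i; exists a, b; rewrite tens_dual_tens.
have delta_cone (U : vectType R) (K : cvx U) (x : K) : state_cone (delta x).
  by move=> f f0; rewrite deltaE; exact: f0.
split=> [f g f0 g0|]; rewrite linear_sum; last first.
  rewrite -w1; apply: eq_bigr => i _; rewrite linearZ /=.
  have [a [b ->]] := sE (ev (Aone KA)) (ev (Aone KB)) i.
  by rewrite !evE !deltaE mulr1; exact: mulr1.
apply: sumr_ge0 => i _; rewrite linearZ /=; have [a [b ->]] := sE f g i.
by apply: mulr_ge0 => //; apply: mulr_ge0; [exact: f0 | exact: g0].
Qed.

(* Empty for n = 0, where the notion is undefined. *)
Definition Ext (n : nat) : set (tensor A' B') :=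
  if n is m.+1 then
    [set x | cvx_set max_states x /\ exists y : tensor_pow A' B' m.+1,
      [/\ max_states_pow y, perm_invariant y &
          x = marginal (ev (Aone KB)) y]]
  else set0.

End composite.
Arguments max_states {R VA VB} KA KB.
Arguments max_states_pow {R VA VB} KA KB n _.
Arguments separable {R VA VB} KA KB _.
Arguments Ext {R VA VB} KA KB n _.

(* Main.v *)
From HB Require Import structures.
From mathcomp Require Import all_boot all_order all_algebra.
From mathcomp Require Import all_classical all_reals all_analysis.
From mathcomp Require Import perm lra ring.
(* Last, so that [contract] is the contraction of tensors and not the map of that
   name on the extended reals. *)
Require Import Defs.
Set Implicit Arguments.
Unset Strict Implicit.
Unset Printing Implicit Defensive.
Import Order.TTheory GRing.Theory Num.Theory.
Import numFieldNormedType.Exports.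
Local Open Scope classical_set_scope.
Local Open Scope ring_scope.

(** Why an n-extendible state is within O(1 / sqrt n) of a separable one.

Fix effects e_j >= 0 on K_B with sum 1 that span A(K_B) ([effect_frame]).  Let
y extend x to n copies of B, and measure all n copies with the e_j.  An outcome
word w leaves the unnormalised state a_w of A ([post]); let q_w be the vector
of frequencies of the n outcomes.  By symmetry of y, testing the B side of x
with e_j gives exactly an average of these frequencies:
  (id ⊗ e_j)(x) = sum_w q_w(j) a_w      ([extension_contract]).
Were each q_w the statistics (e_j(b_w))_j of some b_w in K_B, then
x = sum_w a_w ⊗ b_w would be separable.  In general q_w is replaced by the
nearest point pi(q_w) of the convex compact set of statistics, which gives the
separable state x' = sum_w a_w ⊗ pi(q_w); what remains is to bound the
expected distance from q_w to that set.

This is Blackwell's approachability argument.  After M outcomes with counts s,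
the next copy of B, conditionally on the past, is in a state b of K_B, because
contracting an element of a maximal tensor product with positive functionals
keeps it in the remaining cone ([cone_contract]).  So the next increment of s
has mean (e_j(b))_j, which lies in the convex set, and the deviation of s from
M pi(s / M) makes an obtuse angle with (e_j(b))_j - pi(s / M).  Hence the
square of M times the distance grows by at most 2 in expectation
([energy_step]); after n outcomes the mean squared distance is at most 2 / n
([expected_energy]).

The difference x' - x is then a combination of the a_w ⊗ delta b_j, with
coefficients c_j (e_j(pi(q_w)) - q_w(j)), where c_j and b_j come from the frame
and do not depend on n.  An affine function of norm at most 1 is bounded by the
mass of a_w on each of these tensors ([affine_ext_bound]), so the arithmetic
mean inequality |v| <= (sqrt n v^2 + 1 / sqrt n) / 2 concludes
([mean_abs_le]). *)

(** * Affine functions on a convex set *)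

Section affine_functions.
Variables (R : realType) (V : vectType R).

(** The coefficients may be negative: moving the negative ones to the other side
turns the identity into an equality of two barycentres, to which Jensen's
equality for affine functions applies. *)
Lemma AK_affine_comb (K : cvx V) (I : finType) (c : I -> R) (b : I -> K) (x : K) :
  \sum_i c i = 1 -> val x = \sum_i c i *: val (b i) ->
  forall f : AK K, f x = \sum_i c i * f (b i).
Proof.
move=> c1 xE f.
pose cp i := Num.max 0 (c i); pose cn i := Num.max 0 (- c i).
have cE i : cp i = c i + cn i.
  by rewrite /cn /cp; case: (lerP 0 (c i)); case: (lerP 0 (- c i)); lra.
pose ps := [seq (cp i, b i) | i <- index_enum I].
pose ns := (1 : R, x) :: [seq (cn i, b i) | i <- index_enum I].
have [|p [pE pfE]] := @AK_jensen _ _ K x ps.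
  by rewrite all_map; apply/allP => i _ /=; rewrite le_max lexx.
have [|n [nE nfE]] := @AK_jensen _ _ K x ns.
  by rewrite /= ler01 all_map; apply/allP => i _ /=; rewrite le_max lexx.
have WE : \sum_(q <- ns) q.1 = \sum_(q <- ps) q.1.
  rewrite big_cons !big_map /= -c1 -big_split /=.
  by apply: eq_bigr => i _; rewrite cE.
have W_gt0 : 0 < \sum_(q <- ps) q.1.
  rewrite -WE big_cons big_map /= ltr_wpDr//.
  by apply: sumr_ge0 => i _; rewrite le_max lexx.
have np : n = p.
  apply: val_inj; apply: (scalerI (lt0r_neq0 W_gt0)).
  rewrite -[in LHS]WE nE pE big_cons !big_map /= scale1r xE -big_split /=.
  by apply: eq_bigr => i _; rewrite cE scalerDl.
have := nfE f; rewrite WE np pfE big_cons !big_map /= mul1r => /eqP.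
rewrite -subr_eq => /eqP <-; rewrite -sumrB; apply: eq_bigr => i _.
by rewrite cE -mulrBl addrK.
Qed.

(** Finitely many points b_k determine every affine function, through coefficients
that are themselves affine: lift x to (1, x), so that affine combinations become
linear ones, and expand (1, x) on a spanning family of lifted points.  This one
formula yields the continuity, the boundedness and the linear extension of
affine functions, and the reflexivity of A(K). *)
Lemma affine_frame (K : cvx V) :
  exists (m : nat) (b : 'I_m -> K) (h : 'I_m -> {linear (R^o * V)%type -> R^o}),
  forall (f : AK K) x, f x = \sum_k f (b k) * h k (1, val x).
Proof.
pose hat (x : K) : R^o * V := (1, val x).
have [s sP] := max_dimv_span hat.
pose X := map_tuple hat (in_tuple s).
exists (size s), (tnth (in_tuple s)), (fun k => coord X k) => f x.
have xE : hat x = \sum_i coord X i (hat x) *: hat (tnth (in_tuple s) i).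
  rewrite [LHS](@coord_span _ _ _ X _ (sP x)).
  by apply: eq_bigr => i _; rewrite -tnth_nth tnth_map.
under eq_bigr do rewrite mulrC.
apply: AK_affine_comb.
  have /(congr1 fst)/esym := xE.
  rewrite (big_morph fst (id1 := 0) (op1 := +%R))//= => xE1; rewrite -[RHS]xE1.
  by apply: eq_bigr => i _; rewrite -[RHS]/(_ * 1) mulr1.
by have /(congr1 snd) := xE; rewrite (big_morph snd (id1 := 0) (op1 := +%R)).
Qed.

Lemma AK_linear_extension (K : cvx V) (f : AK K) :
  exists h : 'Hom((R^o * V)%type, R^o), forall x : K, f x = h (1, val x).
Proof.
have [m [b [h fE]]] := affine_frame K.
exists (\sum_k f (b k) *: linfun (h k)) => x.
by rewrite sum_lfunE fE; apply: eq_bigr => k _; rewrite scale_lfunE lfunE.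
Qed.

Lemma AK_of_linear (K : cvx V) (h : {linear (R^o * V)%type -> R^o}) :
  exists f : AK K, forall x : K, f x = h (1, val x).
Proof.
have hP : (fun x : K => h (1, val x)) \in affine_pred K.
  apply/asboolP => x y z t t01 zE.
  have -> : (1 : R^o, val z) = t *: (1 : R^o, val x) + (1 - t) *: (1, val y).
    rewrite zE; congr pair; rewrite -[RHS]/(t * 1 + (1 - t) * 1); lra.
  by rewrite linearD !linearZ.
by exists (MkAK hP).
Qed.

Lemma continuous_sum (T : topologicalType) (I : Type) (r : seq I) (F : I -> T -> R) :
  (forall i, continuous (F i)) -> continuous (fun x => \sum_(i <- r) F i x : R).
Proof.
have cD : continuous (fun z : R * R => z.1 + z.2) by exact: add_continuous.
by move=> Fc; apply: (continuous_big cD).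
Qed.

Lemma continuous_affine_rV n (a : R) (c : 'I_n -> R) :
  continuous (fun r : 'rV[R]_n => a + \sum_i r 0 i * c i : R).
Proof.
move=> r; apply: (@continuousD R R _ (fun=> a)
  (fun r : 'rV[R]_n => \sum_i r 0 i * c i)).
  exact: cst_continuous.
move: r; apply: (@continuous_sum _ _ _ (fun i (r : 'rV[R]_n) => r 0 i * c i)).
move=> i r; apply: (@cvgMr_tmp _ _ (nbhs r) _ (fun r : 'rV[R]_n => r 0 i : R)).
exact: coord_continuous.
Qed.

Lemma continuous_sqdist (T : topologicalType) (J : finType) (q : J -> R)
    (F : J -> T -> R) (s : R) :
  (forall j, continuous (F j)) ->
  continuous (fun x => s * \sum_j (q j - F j x) ^+ 2 : R).
Proof.
move=> Fc x; apply: (@cvgMl_tmp R _ (nbhs x)); move: x.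
apply: (@continuous_sum _ _ _ (fun j x => (q j - F j x) ^+ 2)) => j x.
apply: (@continuous_comp _ _ _ (fun x => q j - F j x) (fun y : R => y ^+ 2)).
  apply: (@continuousB R R _ (fun=> q j) (F j)); last exact: Fc.
  exact: cst_continuous.
exact: exprn_continuous.
Qed.

(** States are seen through a finite family f of affine functions: this puts them
in one Euclidean space with the vectors q of outcome frequencies, which need not
come from any state. *)
Definition sqdist (K : cvx V) (J : finType) (f : J -> AK K) (q : J -> R) (x : K) : R :=
  \sum_j (q j - f j x) ^+ 2.

(** The factor s lets the same statement provide minima (s = 1) and, for a single
function, upper bounds (s = -1). *)
Lemma sqdist_argmin (K : state_space V) (J : finType) (f : J -> AK K)
    (q : J -> R) (s : R) :
  exists x0 : K, forall x : K, s * sqdist f q x0 <= s * sqdist f q x.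
Proof.
have [h hE] := choice (fun j => AK_linear_extension (f j)).
pose e := vbasis {:V}.
pose F (r : 'rV[R]_(\dim {:V})) : R := s *
   \sum_j (q j - (h j (1, 0) + \sum_i r 0 i * h j (0, e`_i))) ^+ 2.
have FE (x : K) : F (passmx.rVof e (val x)) = s * sqdist f q x.
  congr (_ * _); apply: eq_bigr => j _; congr ((_ - _) ^+ 2).
  rewrite hE [in RHS](coord_vbasis (memvf (val x))).
  have -> : (1 : R^o, \sum_i coord e i (val x) *: e`_i) =
      (1, 0) + \sum_i coord e i (val x) *: (0 : R^o, e`_i).
    apply/eqP; rewrite -pair_eqE /=; apply/andP; split; apply/eqP.
      rewrite (big_morph fst (id1 := 0) (op1 := +%R))//=.
      by rewrite big1 ?addr0// => i _; rewrite scaler0.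
    by rewrite (big_morph snd (id1 := 0) (op1 := +%R))//= add0r.
  rewrite linearD linear_sum /=; congr (_ + _).
  by apply: eq_bigr => i _; rewrite mxE linearZ.
have Fc : continuous F.
  apply: (@continuous_sqdist _ _ _ (fun j (r : 'rV[R]_(\dim {:V})) =>
    h j (1, 0) + \sum_i r 0 i * h j (0, e`_i))) => j.
  exact: continuous_affine_rV.
have K_neq0 : passmx.rVof e @` K !=set0.
  by have [x xK] := @state_nonempty _ _ K; exists (passmx.rVof e x), x.
have [_ /set_mem [x0 x0K <-] cmin] :=
  EVT_min_rV K_neq0 (@state_compact _ _ K) (continuous_subspaceT Fc).
exists (SigSub (mem_set x0K)) => x.
by rewrite -!FE; apply: cmin; apply/mem_set; exists (val x) => //; exact/set_mem/valP.
Qed.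

End affine_functions.

(** * Nearest points and informationally complete effects *)

Section effects.
Variables (R : realType) (V : vectType R).

Lemma AK_sumE (K : cvx V) (I : Type) (r : seq I) (f : I -> AK K) (x : K) :
  (\sum_(i <- r) f i) x = \sum_(i <- r) f i x.
Proof. by rewrite -deltaE linear_sum; apply: eq_bigr => i _; exact: deltaE. Qed.

Lemma AK_scaleE (K : cvx V) (a : R) (f : AK K) (x : K) : (a *: f) x = a * f x.
Proof. by []. Qed.

Lemma AK_ext (K : cvx V) (f g : AK K) : (forall x, f x = g x) -> f = g.
Proof. by move=> fg; apply: val_inj; apply/funext. Qed.

(** Convexity enters here: moving from a nearest point x0 straight towards x stays
in the set, so it cannot decrease the distance to first order. *)
Lemma sqdist_projection (K : state_space V) (J : finType) (f : J -> AK K)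
    (q : J -> R) :
  exists x0 : K, (forall x : K, sqdist f q x0 <= sqdist f q x) /\
    forall x : K, \sum_j (q j - f j x0) * (f j x - f j x0) <= 0.
Proof.
have [x0 x0min] := sqdist_argmin f q 1.
have {}x0min x : sqdist f q x0 <= sqdist f q x by have := x0min x; rewrite !mul1r.
exists x0; split=> // x; rewrite leNgt; apply/negP.
set S := \sum_j _ => S_gt0.
pose Q := \sum_j (f j x - f j x0) ^+ 2.
have Q_ge0 : 0 <= Q by apply: sumr_ge0 => j _; exact: sqr_ge0.
have SQ_gt0 : 0 < S + Q by rewrite ltr_pwDl.
(* The minimum of - 2 t S + t ^ 2 Q is at S / Q; S / (S + Q) stays in [0, 1] and
   still makes that expression negative. *)
pose t := S / (S + Q).
have t_gt0 : 0 < t by rewrite divr_gt0.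
have t01 : 0 <= t <= 1 by rewrite ltW//= ler_pdivrMr// mul1r lerDl.
have yK : (t *: val x + (1 - t) *: val x0) \in (K : set V).
  have := @cvx_convex _ _ K (val x) (val x0) (Itv01 (andP t01).1 (andP t01).2).
  by apply; apply: valP.
pose y : K := SigSub yK.
have /(_ y) := x0min; rewrite leNgt => /negP; apply.
have -> : sqdist f q y = sqdist f q x0 - 2 * t * S + t ^+ 2 * Q.
  rewrite /sqdist /S /Q !mulr_sumr -sumrB -big_split /=; apply: eq_bigr => j _.
  by rewrite (AKP (f j) t01 (erefl : val y = _)) /=; ring.
have tE : t * (S + Q) = S by rewrite divfK// gt_eqF.
suff : 0 < t * (2 * S - t * Q) by lra.
rewrite mulr_gt0//; have : 0 < t * S by rewrite mulr_gt0.
lra.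
Qed.

Lemma AK_bounded (K : state_space V) (f : AK K) : exists B : R, forall x : K, `|f x| <= B.
Proof.
have [x0 x0max] := sqdist_argmin (fun _ : 'I_1 => f) (fun=> 0) (-1).
exists `|f x0| => x.
have := x0max x; rewrite /sqdist !big_ord1 !sub0r !sqrrN !mulN1r lerN2.
rewrite -[f x ^+ 2]real_normK ?num_real// -[f x0 ^+ 2]real_normK ?num_real//.
by rewrite ler_sqr ?nnegrE.
Qed.

(** A frame whose coefficient functions are effects: the affine functions h_k of
[affine_frame] are bounded by some H, and the pair of effects proportional to
1 + h_k / H and 1 - h_k / H has a difference proportional to h_k. *)
Lemma effect_frame (K : state_space V) :
  exists (J : finType) (e : J -> AK K) (b : J -> K) (c : J -> R),
  [/\ forall j, Apos (e j), \sum_j e j = Aone K &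
      forall f : AK K, f = \sum_j (c j * f (b j)) *: e j].
Proof.
have [m [b [h' fE']]] := affine_frame K.
have [h hE] := choice (fun k => AK_of_linear K (h' k)).
have {h' fE' hE}fE (f : AK K) x : f x = \sum_k f (b k) * h k x.
  by rewrite fE'; apply: eq_bigr => k _; rewrite hE.
have m_neq0 : m%:R != 0 :> R.
  rewrite pnatr_eq0; apply/eqP => m0; have [x xK] := @state_nonempty _ _ K.
  have := fE (Aone K) (SigSub (mem_set xK)); rewrite big1 => [/eqP|k].
    by rewrite oner_eq0.
  by have := ltn_ord k; rewrite [X in (_ < X)%N]m0.
have [B BP] := choice (fun k => AK_bounded (h k)).
pose H := 1 + \sum_k `|B k|.
have H_gt0 : 0 < H by rewrite ltr_pwDl// sumr_ge0.
have hH k x : `|h k x| <= H.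
  rewrite (le_trans (BP k x))// (le_trans (ler_norm _))//.
  by rewrite /H (bigD1 k)//= addrCA lerDl addr_ge0// sumr_ge0.
pose e (j : 'I_m * bool) : AK K :=
  (2 * m%:R)^-1 *: (Aone K + ((-1) ^+ j.2 / H) *: h j.1).
have eE j x : e j x = (2 * m%:R)^-1 * (1 + (-1) ^+ j.2 / H * h j.1 x) by [].
exists ('I_m * bool)%type, e, (fun j => b j.1),
  (fun j : 'I_m * bool => (-1) ^+ j.2 * H * m%:R).
split=> [j x||f].
- rewrite eE mulr_ge0 ?invr_ge0 ?mulr_ge0 ?ler0n//.
  have := hH j.1 x; rewrite ler_norml => /andP[h1 h2].
  have : `|(-1) ^+ j.2 / H * h j.1 x| <= 1.
    rewrite normrM normrM normr_sign mul1r gtr0_norm ?invr_gt0//.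
    by rewrite mulrC ler_pdivrMr// mul1r.
  by rewrite ler_norml => /andP[]; lra.
- apply: AK_ext => x; rewrite AK_sumE -[RHS]/(1 : R).
  transitivity (\sum_(k < m) (m%:R^-1 : R)).
    under eq_bigr do rewrite eE.
    rewrite -(pair_big xpredT xpredT (fun k (s : bool) =>
      (2 * m%:R)^-1 * (1 + (-1) ^+ s / H * h k x))) /=.
    apply: eq_bigr => k _; rewrite big_bool /= expr0 expr1.
    by field; rewrite m_neq0 gt_eqF.
  by rewrite sumr_const card_ord -[RHS](mulfV m_neq0) mulr_natl.
apply: AK_ext => x; rewrite AK_sumE fE.
under [RHS]eq_bigr do rewrite AK_scaleE eE.
rewrite -(pair_big xpredT xpredT (fun k (s : bool) => (-1) ^+ s * H * m%:R *
  f (b k) * ((2 * m%:R)^-1 * (1 + (-1) ^+ s / H * h k x)))) /=.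
apply: eq_bigr => k _; rewrite big_bool /= expr0 expr1.
by field; rewrite m_neq0 gt_eqF.
Qed.

End effects.

(** * Frames, duality and cones *)

Section cones.
Variable R : realType.

Lemma pairing_ext (V : vectType R) (f g : dual V) :
  (forall v, pairing f v = pairing g v) -> f = g.
Proof. by move=> fg; apply/lfunP. Qed.

Lemma pairing_suml (V : vectType R) (I : Type) (r : seq I) (f : I -> dual V)
    (v : V) :
  pairing (\sum_(i <- r) f i) v = \sum_(i <- r) pairing (f i) v.
Proof. by rewrite /pairing sum_lfunE. Qed.

Lemma pairing_scalel (V : vectType R) (a : R) (f : dual V) (v : V) :
  pairing (a *: f) v = a * pairing f v.
Proof. by rewrite /pairing scale_lfunE. Qed.

Lemma contract_ev_sum (V W : vectType R) (I : Type) (r : seq I) (a : I -> R)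
    (w : I -> W) (z : tensor V (dual W)) :
  contract (ev (\sum_(i <- r) a i *: w i)) z =
  \sum_(i <- r) a i *: contract (ev (w i)) z.
Proof.
have -> : ev (\sum_(i <- r) a i *: w i) = \sum_(i <- r) a i *: ev (w i).
  apply: pairing_ext => f; rewrite evE pairing_suml linear_sum.
  by apply: eq_bigr => i _; rewrite pairing_scalel evE linearZ.
by rewrite /contract linear_sum; apply: eq_bigr => i _; rewrite linearZ.
Qed.

Section frame.
Variables (V : vectType R) (K : cvx V) (J : finType).
Variables (e : J -> AK K) (b : J -> K) (c : J -> R).
Hypothesis frame : forall f : AK K, f = \sum_j (c j * f (b j)) *: e j.

Lemma dual_frame (phi : dual (AK K)) :
  phi = \sum_j (c j * pairing phi (e j)) *: delta (b j).
Proof.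
apply: pairing_ext => f; rewrite pairing_suml {1}[f]frame linear_sum.
by apply: eq_bigr => j _; rewrite linearZ pairing_scalel deltaE; exact: mulrAC.
Qed.

(** Reflexivity of A(K): the frame writes down the element of A(K) that a
functional on A(K)^* evaluates at. *)
Lemma bidual_ev (G : dual (dual (AK K))) : exists f, G = ev f.
Proof.
exists (\sum_j (c j * pairing G (delta (b j))) *: e j).
apply: pairing_ext => phi; rewrite evE {1}[phi]dual_frame !linear_sum.
by apply: eq_bigr => j _; rewrite !linearZ; exact: mulrAC.
Qed.

(** Reduces the comparison of two states of the composite system to that of their
contractions with the effects. *)
Lemma tensor_frame (U : vectType R) (z : tensor U (dual (AK K))) :
  z = \sum_j c j *: tens (contract (ev (e j)) z) (delta (b j)).
Proof.
apply/lfunP => G; have [f ->] := bidual_ev G; rewrite sum_lfunE.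
rewrite -[LHS]/(contract (ev f) z) {1}[f]frame contract_ev_sum.
apply: eq_bigr => j _; rewrite scale_lfunE.
rewrite -[X in _ = _ *: X]/(contract (ev f) (tens _ _)) contract_tens.
by rewrite evE deltaE scalerA.
Qed.

End frame.

Lemma ev_Apos_dual_cone (V : vectType R) (K : cvx V) (f : AK K) :
  Apos f -> dual_cone (@state_cone _ _ K) (ev f).
Proof. by move=> f0 phi phiP; rewrite evE; exact: phiP. Qed.

Lemma Aone_ge0 (V : vectType R) (K : cvx V) : Apos (Aone K).
Proof. by move=> x; exact: ler01. Qed.

(** Normalised positive functionals are evaluations.  Otherwise the statistics of
phi would differ from their nearest point x, and the affine function h, whose
coefficients are the differences u, would be positive on K by the obtuse angle
while phi(h) is - phi(1) times the squared distance. *)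
Lemma state_cone_delta (V : vectType R) (K : state_space V) (phi : dual (AK K)) :
  state_cone phi -> exists x : K, phi = pairing phi (Aone K) *: delta x.
Proof.
move=> phiP; have [J [e [b [c [e_ge0 e_sum frame]]]]] := effect_frame K.
set m := pairing phi (Aone K).
have m_ge0 : 0 <= m by apply: phiP; exact: Aone_ge0.
have mE : m = \sum_j pairing phi (e j) by rewrite /m -e_sum linear_sum.
have [x [_ obt]] := sqdist_projection e (fun j => pairing phi (e j) / m).
exists x; rewrite [LHS](dual_frame frame) [in RHS](dual_frame frame (delta x)).
rewrite scaler_sumr; apply: eq_bigr => j _; rewrite scalerA mulrCA.
congr (_ * _ *: _).
rewrite deltaE; have [m0|m_neq0] := eqVneq m 0.
  (* The values on the effects are nonnegative with sum 0. *)
  rewrite m0 mul0r; apply/eqP.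
  move: mE; rewrite m0 => /esym/eqP; rewrite psumr_eq0 => [/allP|i _].
    by apply; rewrite mem_index_enum.
  exact/phiP/e_ge0.
pose u j := pairing phi (e j) / m - e j x.
pose h : AK K := \sum_j u j *: (e j x *: Aone K - e j).
have hE y : h y = \sum_j u j * (e j x - e j y).
  rewrite AK_sumE; apply: eq_bigr => i _; rewrite AK_scaleE; congr (_ * _).
  by rewrite -[LHS]/(e i x * 1 - e i y) mulr1.
have h_ge0 : Apos h.
  move=> y; rewrite hE -oppr_le0 -sumrN (le_trans _ (obt y))//.
  by apply: ler_sum => i _; rewrite -mulrN opprB.
have := phiP h h_ge0; rewrite linear_sum.
have -> : \sum_i pairing phi (u i *: (e i x *: Aone K - e i)) = - (m * \sum_i u i ^+ 2).
  rewrite mulr_sumr -sumrN; apply: eq_bigr => i _.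
  rewrite linearZ linearB linearZ -/m /u /=.
  by rewrite -[_ *: (_ - _)]/(_ * (_ * _ - _)); field.
rewrite oppr_ge0 pmulr_rle0 ?lt_neqAle 1?eq_sym ?m_neq0// => su.
have : \sum_i u i ^+ 2 == 0.
  by rewrite eq_le su sumr_ge0// => i _; exact: sqr_ge0.
rewrite psumr_eq0 => [/allP/(_ j)|i _]; last exact: sqr_ge0.
rewrite mem_index_enum sqrf_eq0 subr_eq0 => /(_ isT)/eqP uj.
by rewrite -uj mulrC divfK.
Qed.

(** The nontrivial half of C^** = C.  It holds by construction for cones
that are defined by inequalities, which all cones below are. *)
Definition bipolar (V : vectType R) (C : set V) :=
  forall v, (forall f, dual_cone C f -> 0 <= pairing f v) -> C v.

Lemma bipolar_state_cone (V : vectType R) (K : cvx V) :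
  bipolar (@state_cone _ _ K).
Proof. by move=> phi phiP f f0; rewrite -evE; exact/phiP/ev_Apos_dual_cone. Qed.

Lemma bipolar_max_tensor (V W : vectType R) (C : set V) (D : set W) :
  bipolar (max_tensor C D).
Proof. by move=> z zP f g fC gD; apply: zP => y yP; exact: yP. Qed.

Lemma bipolar_max_tensor_pow (V W : vectType R) (C : set V) (D : set W) n :
  bipolar C -> bipolar (max_tensor_pow C D n).
Proof. by case: n => [//|n] _; exact: bipolar_max_tensor. Qed.

Lemma max_tensor_contract (V W : vectType R) (C : set V) (D : set W)
    (g : dual W) (z : tensor V W) :
  bipolar C -> dual_cone D g -> max_tensor C D z -> C (contract g z).
Proof. by move=> CC gD zP; apply: CC => f fC; rewrite -tens_dualE; exact: zP. Qed.

End cones.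

(** * Approachability *)

Section approachability.
Variables (R : realType) (V : vectType R) (K : cvx V) (J : finType).
Variable e : J -> AK K.
Hypotheses (e_ge0 : forall j, Apos (e j)) (e_sum : \sum_j e j = Aone K).
Variable proj : (J -> R) -> K.
Hypothesis proj_min : forall q x, sqdist e q (proj q) <= sqdist e q x.
Hypothesis proj_obtuse : forall q x,
  \sum_j (q j - e j (proj q)) * (e j x - e j (proj q)) <= 0.

(** The squared distance from the counts s after M outcomes to M times the set of
statistics of states; it is 0 for M = 0, whatever s. *)
Definition energy (M : nat) (s : J -> R) : R :=
  M%:R ^+ 2 * sqdist e (fun j => s j / M%:R) (proj (fun j => s j / M%:R)).

Lemma effect_sum1 (x : K) : \sum_j e j x = 1.
Proof. by rewrite -AK_sumE e_sum. Qed.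

(** Both points lie in the probability simplex, where (s - t)^2 <= s + t for each
coordinate. *)
Lemma outcome_sqdist (j : J) (x : K) : sqdist e (fun k => (j == k)%:R) x <= 2.
Proof.
rewrite (@le_trans _ _ (\sum_k ((j == k)%:R + e k x)))//.
  apply: ler_sum => k _; have e0 := e_ge0 k x.
  have e1 : e k x <= 1.
    by rewrite -(effect_sum1 x) (bigD1 k)//= lerDl sumr_ge0// => i _; exact: e_ge0.
  have : e k x ^+ 2 <= e k x by rewrite expr2 ler_piMr.
  by case: (j == k) => /=; lra.
rewrite big_split /= effect_sum1 (bigD1 j)//= eqxx big1 => [|k kj].
  by rewrite mulr1n; lra.
by rewrite eq_sym (negbTE kj).
Qed.

(** Here x is the state of the next copy, which gives outcome j with probability
e_j(x).  The new counts are compared with M + 1 times the old nearest point y: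
the cross term has a nonpositive mean by the obtuse angle at y, and the
remaining square is that of [outcome_sqdist].  At M = 0 the angle says nothing,
and the cross term vanishes because the counts are 0. *)
Lemma energy_step (M : nat) (s : J -> R) (x : K) :
  (M = 0%N -> forall k, s k = 0) ->
  \sum_j e j x * energy M.+1 (fun k => s k + (j == k)%:R) <= energy M s + 2.
Proof.
move=> s0; set y := proj (fun j => s j / M%:R).
pose u k := s k - M%:R * e k y.
have uE k : u k = M%:R * (s k / M%:R - e k y).
  rewrite /u; case: (posnP M) => [M0|M_gt0].
    by rewrite (s0 M0) M0 mul0r !mul0r subrr.
  by field; rewrite pnatr_eq0 -lt0n.
have EM : energy M s = \sum_k u k ^+ 2.
  by rewrite /energy /sqdist mulr_sumr; apply: eq_bigr => k _; rewrite uE exprMn.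
(* The cross term is kept here: it is nonpositive only on average over j. *)
have EM1 j : energy M.+1 (fun k => s k + (j == k)%:R) <=
    energy M s + 2 * \sum_k u k * ((j == k)%:R - e k y) + 2.
  set q := fun k => (s k + (j == k)%:R) / M.+1%:R.
  have : energy M.+1 (fun k => s k + (j == k)%:R) <= M.+1%:R ^+ 2 * sqdist e q y.
    by apply: ler_wpM2l; [exact: sqr_ge0 | exact: proj_min].
  move=> /le_trans; apply.
  have -> : M.+1%:R ^+ 2 * sqdist e q y = energy M s +
      2 * (\sum_k u k * ((j == k)%:R - e k y)) + sqdist e (fun k => (j == k)%:R) y.
    rewrite EM /sqdist !mulr_sumr -!big_split /=; apply: eq_bigr => k _.
    by rewrite /q /u -natr1; field; rewrite natr1 pnatr_eq0.
  by rewrite lerD2l; exact: outcome_sqdist.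
rewrite (@le_trans _ _ (\sum_j e j x *
    (energy M s + 2 * \sum_k u k * ((j == k)%:R - e k y) + 2)))//.
  by apply: ler_sum => j _; apply: ler_wpM2l; [exact: e_ge0 | exact: EM1].
have -> : \sum_j e j x *
      (energy M s + 2 * (\sum_k u k * ((j == k)%:R - e k y)) + 2) =
    energy M s + 2 + 2 * \sum_k u k * (e k x - e k y).
  under eq_bigr do rewrite addrAC mulrDr.
  rewrite big_split /= -mulr_suml effect_sum1 mul1r; congr (_ + _).
  under eq_bigr do rewrite mulrCA mulr_sumr.
  rewrite -mulr_sumr exchange_big /=; congr (_ * _); apply: eq_bigr => k _.
  under eq_bigr do rewrite mulrCA.
  rewrite -mulr_sumr; congr (_ * _).
  under eq_bigr do rewrite mulrBr.
  rewrite sumrB -mulr_suml effect_sum1 mul1r; congr (_ - _).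
  rewrite (bigD1 k)//= eqxx mulr1 big1 ?addr0// => j jk.
  by rewrite (negbTE jk) mulr0.
rewrite gerDl; apply: mulr_ge0_le0 => //.
under eq_bigr do rewrite uE -mulrA.
by rewrite -mulr_sumr; apply: mulr_ge0_le0; [exact: ler0n | exact: proj_obtuse].
Qed.

End approachability.

(** * Measuring all the copies *)

(** Words of n outcomes, the first letter being that of the last tensor factor:
the copies are measured from the outermost inwards, which is the order in which
the iterated tensor product is built. *)
Fixpoint outcomes (J : finType) (n : nat) : finType :=
  if n is m.+1 then (J * outcomes J m)%type else unit.

Fixpoint count_outcome (J : finType) (n : nat) : outcomes J n -> J -> nat :=
  match n return outcomes J n -> J -> nat with
  | 0 => fun _ _ => 0
  | m.+1 => fun w k => ((w.1 == k) + count_outcome w.2 k)%N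
  end.

Section measurement.
Variables (R : realType) (VA VB : vectType R) (KA : cvx VA) (KB : cvx VB).
Local Notation A' := (dual (AK KA)).
Local Notation B' := (dual (AK KB)).
Local Notation oneB := (ev (Aone KB)).
Local Notation cone := (max_tensor_pow (@state_cone _ _ KA) (@state_cone _ _ KB)).

Definition trace_out n (f : dual A') (y : tensor_pow A' B' n) : R :=
  pairing (tens_dual_pow f (fun=> oneB)) y.

Definition effect_at n (l : 'I_n) (g : AK KB) : 'I_n -> dual B' :=
  fun i => if i == l then ev g else oneB.

Lemma trace_outS n (f : dual A') (y : tensor_pow A' B' n.+1) :
  trace_out f y = trace_out (n := n) f (contract oneB y).
Proof. exact: tens_dualE. Qed.

Lemma trace_out_sum n (f : dual A') (I : finType) (a : I -> R)
    (y : I -> tensor_pow A' B' n) :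
  trace_out f (\sum_i a i *: y i) = \sum_i a i * trace_out f (y i).
Proof. by rewrite /trace_out linear_sum; apply: eq_bigr => i _; rewrite linearZ. Qed.

Variables (J : finType) (e : J -> AK KB).
Hypotheses (e_ge0 : forall j, Apos (e j)) (e_sum : \sum_j e j = Aone KB).

(** The unnormalised state of A conditional on the word w; its mass is the
probability of w. *)
Fixpoint post n : tensor_pow A' B' n -> outcomes J n -> A' :=
  match n return tensor_pow A' B' n -> outcomes J n -> A' with
  | 0 => fun y _ => y
  | m.+1 => fun y w => post (n := m) (contract (ev (e w.1)) y) w.2
  end.

Lemma cone_contract n (y : tensor_pow A' B' n.+1) (g : AK KB) :
  Apos g -> cone n.+1 y -> cone n (contract (ev g) y).
Proof.
move=> g_ge0; apply: max_tensor_contract; last exact: ev_Apos_dual_cone.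
by apply: bipolar_max_tensor_pow; exact: bipolar_state_cone.
Qed.

Lemma trace_out_ge0 n (y : tensor_pow A' B' n) :
  cone n y -> 0 <= trace_out (ev (Aone KA)) y.
Proof.
elim: n y => [|n IH] y yC.
  by rewrite -[trace_out _ _]/(pairing (ev _) _) evE; apply: yC; exact: Aone_ge0.
by rewrite trace_outS; apply/IH/cone_contract => //; exact: Aone_ge0.
Qed.

Lemma post_cone n (y : tensor_pow A' B' n) w : cone n y -> state_cone (post y w).
Proof. by elim: n y w => [//|n IH] y w yC; apply/IH/cone_contract. Qed.

Lemma sum_outcomesS n (F : outcomes J n.+1 -> R) :
  \sum_w F w = \sum_j \sum_w F (j, w).
Proof. by rewrite pair_bigA; apply: eq_bigr => -[]. Qed.

Lemma contract_effects (U : vectType R) (z : tensor U B') :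
  contract oneB z = \sum_j contract (ev (e j)) z.
Proof.
have -> : Aone KB = \sum_j (1 : R) *: e j.
  by rewrite -e_sum; apply: eq_bigr => j _; rewrite scale1r.
by rewrite contract_ev_sum; apply: eq_bigr => j _; rewrite scale1r.
Qed.

Lemma sum_contract n (f : dual A') (y : tensor_pow A' B' n.+1) :
  \sum_j trace_out (n := n) f (contract (ev (e j)) y) = trace_out f y.
Proof. by rewrite trace_outS contract_effects /trace_out linear_sum. Qed.

Lemma post_sum n (f : dual A') (y : tensor_pow A' B' n) :
  \sum_w pairing f (post y w) = trace_out f y.
Proof.
elim: n y => [|n IH] y; first by rewrite /= (big_pred1 tt) => // -[].
rewrite sum_outcomesS -sum_contract.
by apply: eq_bigr => j _; rewrite -IH.
Qed.

(** The number of occurrences of k is a sum over the slots, and the term of slot l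
averages to the functional that tests e_k there and nothing elsewhere. *)
Lemma post_count n (f : dual A') (y : tensor_pow A' B' n) (k : J) :
  \sum_w (count_outcome w k)%:R * pairing f (post y w) =
  \sum_(l < n) pairing (tens_dual_pow f (effect_at l (e k))) y.
Proof.
elim: n y => [|n IH] y; first by rewrite /= (big_pred1 tt) ?mul0r ?big_ord0// => -[].
rewrite sum_outcomesS big_ord_recr /= addrC.
under eq_bigr => j _ do under eq_bigr => w _ do rewrite /= natrD mulrDl.
under eq_bigr do rewrite big_split -mulr_sumr post_sum /=.
rewrite big_split /=; congr (_ + _).
  rewrite (bigD1 k)//= eqxx mul1r big1 ?addr0 => [|j jk]; last first.
    by rewrite (negbTE jk) mul0r.
  rewrite tens_dualE /effect_at eqxx /trace_out; congr (pairing (tens_dual_pow _ _) _).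
  by apply/funext => i; rewrite -val_eqE /= ltn_eqF.
under eq_bigr do rewrite IH.
rewrite exchange_big /=; apply: eq_bigr => l _.
rewrite tens_dualE.
have -> : effect_at (widen_ord (leqnSn n) l) (e k) ord_max = oneB.
  by rewrite /effect_at -val_eqE /= gtn_eqF.
have -> : (fun i : 'I_n => effect_at (widen_ord (leqnSn n) l) (e k)
    (widen_ord (leqnSn n) i)) = effect_at l (e k).
  by apply/funext => i; rewrite /effect_at -val_eqE.
by rewrite contract_effects linear_sum.
Qed.

Variable proj : (J -> R) -> KB.
Hypothesis proj_min : forall q x, sqdist e q (proj q) <= sqdist e q x.
Hypothesis proj_obtuse : forall q x,
  \sum_j (q j - e j (proj q)) * (e j x - e j (proj q)) <= 0.

(** One copy is measured at a time.  By [energy_step] the bound on the next step is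
a positive affine function g of the state of that copy, hence it survives
contraction with g, whatever the correlations with the other copies. *)
Lemma expected_energy n (y : tensor_pow A' B' n) (M : nat) (s : J -> R) :
  cone n y -> (M = 0%N -> forall k, s k = 0) ->
  \sum_w pairing (ev (Aone KA)) (post y w) *
     energy e proj (M + n) (fun k => s k + (count_outcome w k)%:R) <=
  trace_out (ev (Aone KA)) y * (energy e proj M s + 2 * n%:R).
Proof.
elim: n y M s => [|n IH] y M s yC s0.
  rewrite /= (big_pred1 tt) => [|[]//]; rewrite addn0 mulr0 addr0.
  by have -> : (fun k => s k + 0) = s by apply/funext => k; rewrite addr0.
rewrite sum_outcomesS.
pose m j := trace_out (n := n) (ev (Aone KA)) (contract (ev (e j)) y).
pose s' j k := s k + (j == k)%:R.
rewrite (@le_trans _ _ (\sum_j m j * (energy e proj M.+1 (s' j) + 2 * n%:R)))//.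
  apply: ler_sum => j _.
  rewrite (le_trans _ (IH (contract (ev (e j)) y) M.+1 (s' j) _ _))//; last first.
    exact: cone_contract.
  rewrite le_eqVlt; apply/orP; left; apply/eqP; apply: eq_bigr => w _ /=.
  rewrite addnS addSn; congr (_ * energy _ _ _ _).
  by apply/funext => k; rewrite natrD addrA.
set E := energy e proj M s.
have mE : \sum_j m j = trace_out (ev (Aone KA)) y by rewrite sum_contract.
pose g : AK KB := \sum_j (E + 2 - energy e proj M.+1 (s' j)) *: e j.
have g_ge0 : Apos g.
  move=> x; rewrite AK_sumE.
  under eq_bigr do rewrite AK_scaleE mulrBl [energy _ _ _ _ * _]mulrC.
  rewrite sumrB -mulr_sumr effect_sum1// mulr1 subr_ge0.
  exact: energy_step.
have := trace_out_ge0 (cone_contract g_ge0 yC).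
rewrite contract_ev_sum (@trace_out_sum n).
under eq_bigr do rewrite -/(m _) mulrBl [energy _ _ _ _ * _]mulrC.
rewrite sumrB -mulr_sumr mE subr_ge0 => gE.
under eq_bigr do rewrite mulrDr.
rewrite big_split /= -mulr_suml mE -natr1.
apply: le_trans (lerD gE (lexx _)) _.
by rewrite le_eqVlt; apply/orP; left; apply/eqP; ring.
Qed.

End measurement.

(** * Comparison with a separable state *)

Section comparison.
Variable R : realType.

Lemma unit_norm_le1 (V : vectType R) (K : cvx V) (g : AK K) (x : K) :
  (unit_norm g <= 1)%E -> `|g x| <= 1.
Proof.
move=> g1; rewrite -lee_fin; apply: le_trans g1.
apply: le_ereal_inf_tmp => _ [t [t0 h1 h2] <-]; rewrite lee_fin ler_norml.
have {h1} := h1 x; have {h2} := h2 x.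
rewrite -!deltaE linearB linearD !linearZ /= !deltaE.
rewrite -![_ *: _]/(_ * 1) mulr1; lra.
Qed.

Lemma tens_suml (V W : vectType R) (I : finType) (a : I -> R) (v : I -> V) (w : W) :
  tens (\sum_i a i *: v i) w = \sum_i a i *: tens (v i) w.
Proof.
apply/lfunP => g; rewrite -[LHS]/(contract g _) contract_tens sum_lfunE scaler_sumr.
apply: eq_bigr => i _; rewrite scale_lfunE.
by rewrite -[X in _ = _ *: X]/(contract g (tens _ _)) contract_tens !scalerA mulrC.
Qed.

Lemma tens_scalel (V W : vectType R) (a : R) (v : V) (w : W) :
  tens (a *: v) w = a *: tens v w.
Proof. by have := tens_suml (fun _ : 'I_1 => a) (fun=> v) w; rewrite !big_ord1. Qed.

Lemma marginal_effect (VA VB : vectType R) (KA : cvx VA) (KB : cvx VB) n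
    (f : dual (dual (AK KA))) (g : AK KB)
    (y : tensor_pow (dual (AK KA)) (dual (AK KB)) n.+1) :
  pairing f (contract (ev g) (marginal (ev (Aone KB)) y)) =
  pairing (tens_dual_pow f (effect_at ord0 g)) y.
Proof.
elim: n y => [|n IH] y; first by rewrite tens_dualE /effect_at (ord1 ord_max) eqxx.
rewrite [marginal _ _]/= IH [RHS]tens_dualE.
have -> : effect_at ord0 g (ord_max : 'I_n.+2) = ev (Aone KB) by [].
by congr (pairing (tens_dual_pow _ _) _).
Qed.

(** The transposition of l with 0 moves the tested slot to the one that the
marginal keeps. *)
Lemma perm_invariant_effect (VA VB : vectType R) (KA : cvx VA) (KB : cvx VB) n
    (y : tensor_pow (dual (AK KA)) (dual (AK KB)) n.+1)
    (f : dual (dual (AK KA))) (g : AK KB) (l : 'I_n.+1) :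
  perm_invariant y ->
  pairing (tens_dual_pow f (effect_at l g)) y =
  pairing (tens_dual_pow f (effect_at ord0 g)) y.
Proof.
move=> /(_ (tperm ord0 l) f (effect_at ord0 g)) <-.
congr (pairing (tens_dual_pow _ _) _); apply/funext => i.
by rewrite /effect_at /= -(inj_eq (@perm_inj _ (tperm ord0 l))) tpermR.
Qed.

(** The frequencies of the outcomes are an exact hidden-variable model for the
statistics of x: the symmetry makes all the n terms of [post_count] equal to the
one in the slot kept by the marginal. *)
Lemma extension_contract (VA VB : vectType R) (KA : cvx VA) (KB : cvx VB)
    (J : finType) (e : J -> AK KB) n
    (y : tensor_pow (dual (AK KA)) (dual (AK KB)) n.+1) (j : J) :
  \sum_j e j = Aone KB -> perm_invariant y ->
  contract (ev (e j)) (marginal (ev (Aone KB)) y) =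
  \sum_(w : outcomes J n.+1)
    ((count_outcome w j)%:R / n.+1%:R) *: post e y w.
Proof.
move=> e_sum yperm; apply: pairing_ext => f.
have n_neq0 : n.+1%:R != 0 :> R by rewrite pnatr_eq0.
rewrite -[LHS]evE -[RHS]evE marginal_effect linear_sum.
apply: (mulfI n_neq0); rewrite mulr_sumr mulr_natl.
transitivity (\sum_(w : outcomes J n.+1)
    (count_outcome w j)%:R * pairing (ev f) (post e y w)).
  rewrite (post_count e_sum).
  under eq_bigr do rewrite (perm_invariant_effect _ _ _ yperm).
  by rewrite sumr_const card_ord.
apply: eq_bigr => w _.
transitivity (n.+1%:R * ((count_outcome w j)%:R / n.+1%:R *
    pairing (ev f) (post e y w))); last by rewrite linearZ.
by rewrite mulrA [n.+1%:R * _]mulrC divfK.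
Qed.

(** An affine function on the states is a linear function plus a constant; the
constant is made linear by multiplying it by 1 ⊗ 1, which is 1 on states. *)
Lemma max_states_linear (VA VB : vectType R) (KA : cvx VA) (KB : cvx VB)
    (g : AK (max_states KA KB)) :
  exists h : dual (tensor (dual (AK KA)) (dual (AK KB))),
    forall z : max_states KA KB, g z = pairing h (val z).
Proof.
have [h gE] := AK_linear_extension g.
pose unit := tens_dual (ev (Aone KA)) (ev (Aone KB)).
have lin : linear (fun z : tensor (dual (AK KA)) (dual (AK KB)) =>
    h (pairing unit z, z)).
  move=> a z1 z2; rewrite -linearP; congr (h _).
  by rewrite [in LHS](linearP (pairing unit)).
pose l : {linear tensor (dual (AK KA)) (dual (AK KB)) -> R^o} :=
  HB.pack (fun z : tensor (dual (AK KA)) (dual (AK KB)) => h (pairing unit z, z))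
    (GRing.isLinear.Build _ _ _ _ _ lin).
exists (linfun l) => z; rewrite /pairing lfunE gE /= -/(pairing _ _).
by have /set_mem [_ ->] := valP z.
Qed.

(** a ⊗ delta b is the mass of a times a product state, and there g is at most 1. *)
Lemma affine_ext_bound (VA VB : vectType R) (KA : state_space VA) (KB : cvx VB)
    (g : AK (max_states KA KB))
    (h : dual (tensor (dual (AK KA)) (dual (AK KB))))
    (a : dual (AK KA)) (b : KB) :
  (unit_norm g <= 1)%E -> (forall z : max_states KA KB, g z = pairing h (val z)) ->
  state_cone a -> `|pairing h (tens a (delta b))| <= pairing a (Aone KA).
Proof.
move=> g1 hE aC; have [x aE] := state_cone_delta aC.
have m_ge0 : 0 <= pairing a (Aone KA) by apply: aC; exact: Aone_ge0.
pose z := tens (delta x) (delta b).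
have zP : separable KA KB z.
  exists 1, (fun=> 1), (fun=> z).
  split=> [i||i|]; rewrite ?ler01 ?big_ord1 ?scale1r//.
  by exists x => //; exists b.
rewrite {1}aE tens_scalel.
have -> : pairing h (pairing a (Aone KA) *: z) = pairing a (Aone KA) * pairing h z.
  by rewrite linearZ.
rewrite normrM ger0_norm// ler_piMr//.
by rewrite -(hE (SigSub (mem_set (separable_max_states zP)))) unit_norm_le1.
Qed.

Lemma separable_sum (VA VB : vectType R) (KA : state_space VA) (KB : cvx VB)
    (I : finType) (a : I -> dual (AK KA)) (b : I -> KB) :
  (forall i, state_cone (a i)) -> \sum_i pairing (a i) (Aone KA) = 1 ->
  separable KA KB (\sum_i tens (a i) (delta (b i))).
Proof.
move=> aC a1; have [x aE] := choice (fun i => state_cone_delta (aC i)).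
exists #|I|, (fun i => pairing (a (enum_val i)) (Aone KA)),
  (fun i => tens (delta (x (enum_val i))) (delta (b (enum_val i)))).
split=> [i||i|]; first by apply: aC; exact: Aone_ge0.
- by rewrite -a1 [RHS]big_enum_val.
- by exists (x (enum_val i)) => //; exists (b (enum_val i)).
by rewrite big_enum_val; apply: eq_bigr => i _; rewrite -tens_scalel {1}aE.
Qed.

Lemma mean_abs_le (I J : finType) (m : I -> R) (v : I -> J -> R) (n : nat) :
  (0 < n)%N -> (forall i, 0 <= m i) -> \sum_i m i = 1 ->
  \sum_i m i * \sum_j v i j ^+ 2 <= 2 / n%:R ->
  \sum_i m i * \sum_j `|v i j| <= (2 + #|J|%:R) / (2 * Num.sqrt n%:R).
Proof.
move=> n_gt0 m_ge0 m1 mv.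
have r_gt0 : 0 < Num.sqrt n%:R :> R by rewrite sqrtr_gt0 ltr0n.
have rK : Num.sqrt n%:R ^+ 2 = n%:R :> R by rewrite sqr_sqrtr// ler0n.
set r : R := Num.sqrt n%:R in r_gt0 rK *.
have abs_le (t : R) : `|t| <= (r * t ^+ 2 + r^-1) / 2.
  have : 0 <= r * (`|t| - r^-1) ^+ 2 by rewrite mulr_ge0 ?sqr_ge0// ltW.
  have -> : r * (`|t| - r^-1) ^+ 2 = r * t ^+ 2 + r^-1 - 2 * `|t|.
    by rewrite -[t ^+ 2]real_normK ?num_real//; field; rewrite gt_eqF.
  by lra.
rewrite (@le_trans _ _ (\sum_i m i *
    (r / 2 * (\sum_j v i j ^+ 2) + #|J|%:R / (2 * r))))//.
  apply: ler_sum => i _; apply: ler_wpM2l => //.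
  have -> : #|J|%:R / (2 * r) = \sum_(j : J) r^-1 / 2.
    by rewrite sumr_const -mulr_natl; field; rewrite gt_eqF.
  rewrite mulr_sumr -big_split /=; apply: ler_sum => j _.
  by rewrite (le_trans (abs_le _))// mulrDl mulrAC.
under eq_bigr do rewrite mulrDr mulrCA.
rewrite big_split /= -mulr_sumr -mulr_suml m1 mul1r.
rewrite [leRHS](_ : _ = r / 2 * (2 / n%:R) + #|J|%:R / (2 * r)).
  by rewrite lerD2r; apply: ler_wpM2l => //; rewrite divr_ge0// ltW.
by rewrite -rK; field; rewrite gt_eqF.
Qed.

End comparison.

Theorem theorem3p7 (R : realType) (VA VB : vectType R)
    (KA : state_space VA) (KB : state_space VB) :
  exists c : R, forall n : nat, (1 <= n)%N ->
  forall x : max_states KA KB, Ext KA KB n (val x) ->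
  exists x' : max_states KA KB, separable KA KB (val x') /\
    (dual_norm (delta x' - delta x) <= (2 * c / Num.sqrt n%:R)%:E)%E.
Proof.
have [J [e [b [c [e_ge0 e_sum frame]]]]] := effect_frame KB.
have [proj projP] := choice (sqdist_projection e).
have proj_min q := (projP q).1; have proj_obtuse q := (projP q).2.
pose C := \sum_j `|c j|.
exists (C * (2 + #|J|%:R) / 4) => -[//|m] _ x [_ [y [[yC y1] yperm xE]]].
set n := m.+1.
pose a w := post e y w; pose mass w := pairing (a w) (Aone KA).
pose q (w : outcomes J n) (j : J) : R := (count_outcome w j)%:R / n%:R.
have aC w : state_cone (a w) by exact: post_cone.
have mass_ge0 w : 0 <= mass w by apply: aC; exact: Aone_ge0.
have mass_sum : \sum_(w : outcomes J n) mass w = 1.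
  by rewrite -[RHS]y1 -[RHS](post_sum e_sum); apply: eq_bigr => w _; rewrite evE.
have n_neq0 : n%:R != 0 :> R by rewrite pnatr_eq0.
have x_contract j :
    contract (ev (e j)) (val x) = \sum_(w : outcomes J n) q w j *: a w.
  by rewrite xE (extension_contract _ e_sum yperm).
pose x0 := \sum_(w : outcomes J n) tens (a w) (delta (proj (q w))).
have x0sep : separable KA KB x0 by exact: separable_sum.
exists (SigSub (mem_set (separable_max_states x0sep))); split=> //.
set x' := SigSub _.
have diffE : val x' - val x = \sum_j c j *:
    \sum_w (e j (proj (q w)) - q w j) *: tens (a w) (delta (b j)).
  rewrite [LHS](tensor_frame frame); apply: eq_bigr => j _; congr (_ *: _).
  rewrite -tens_suml; congr (tens _ _).
  transitivity (contract (ev (e j)) x0 - contract (ev (e j)) (val x)).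
    exact: linearB.
  rewrite x_contract [contract _ x0]linear_sum -sumrB.
  by apply: eq_bigr => w _ /=; rewrite contract_tens evE deltaE scalerBl.
have mean_sqdist :
    \sum_w mass w * sqdist e (q w) (proj (q w)) <= 2 / n%:R.
  have := expected_energy e_ge0 e_sum proj_min proj_obtuse (M := 0)
    (s := fun=> 0) yC (fun _ _ => erefl).
  rewrite add0n [trace_out _ _]y1 mul1r.
  have -> : energy e proj 0 (fun=> 0) = 0 by rewrite /energy expr0n mul0r.
  rewrite add0r.
  have -> : \sum_w pairing (ev (Aone KA)) (post e y w) *
      energy e proj m.+1 (fun k => 0 + (count_outcome w k)%:R) =
      n%:R ^+ 2 * \sum_w mass w * sqdist e (q w) (proj (q w)).
    rewrite mulr_sumr; apply: eq_bigr => w _; rewrite evE mulrCA /energy.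
    by under eq_fun do rewrite add0r.
  rewrite -ler_pdivlMl ?exprn_gt0 ?ltr0n// => /le_trans; apply.
  by rewrite -/n le_eqVlt; apply/orP; left; apply/eqP; field.
apply: ge_ereal_sup => _ [g g1 <-]; rewrite lee_fin.
have -> : pairing (delta x' - delta x) g = g x' - g x.
  by rewrite /pairing add_lfunE opp_lfunE -!/(pairing _ _) !deltaE.
have [h hE] := max_states_linear g.
rewrite !hE.
have -> : pairing h (val x') - pairing h (val x) = \sum_j c j *
    \sum_w (e j (proj (q w)) - q w j) * pairing h (tens (a w) (delta (b j))).
  transitivity (pairing h (val x' - val x)); first exact/esym/linearB.
  rewrite diffE linear_sum; apply: eq_bigr => j _; rewrite linearZ; congr (_ * _).
  by rewrite linear_sum; apply: eq_bigr => w _; rewrite linearZ.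
have h_le w j : `|pairing h (tens (a w) (delta (b j)))| <= mass w.
  exact: (affine_ext_bound _ g1 hE (aC w)).
have c_le j : `|c j| <= C by rewrite /C (bigD1 j)//= lerDl sumr_ge0.
have C_ge0 : 0 <= C by apply: sumr_ge0.
rewrite (le_trans (ler_norm_sum _ _ _))//.
rewrite (@le_trans _ _ (C * \sum_w mass w * \sum_j `|q w j - e j (proj (q w))|))//.
  rewrite mulr_sumr.
  under [leRHS]eq_bigr do rewrite mulr_sumr mulr_sumr.
  rewrite exchange_big /=; apply: ler_sum => j _.
  rewrite normrM -mulr_sumr; apply: ler_pM => //.
  rewrite (le_trans (ler_norm_sum _ _ _))//; apply: ler_sum => w _.
  by rewrite normrM distrC mulrC; apply: ler_wpM2r.
apply: (le_trans (ler_wpM2l C_ge0 (mean_abs_le _ mass_ge0 mass_sum mean_sqdist))) => //.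
rewrite le_eqVlt; apply/orP; left; apply/eqP; field.
by rewrite gt_eqF// sqrtr_gt0 ltr0n.
Qed.
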